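(* Let $A_1,\ldots,A_m\in\mathbb{M}_d$. Then, for all integers $j\ge 0$, $$\lambda_{1+2j}^{\downarrow}\left(\left|\sum_{k=1}^m A_k\right|\right)\le\sqrt{2}\,\lambda_{1+j}^{\downarrow}\left(\sum_{k=1}^m|A_k|_{\mathrm{qsym}}\right).$$
   Context: $d,m\ge 1$ are integers, $\mathbb{M}_d$ is the space of complex $d\times d$ matrices and $\mathbb{M}_d^+$ its cone of positive semidefinite matrices. For $A\in\mathbb{M}_d$, $|A|=(A^*A)^{1/2}$, so $|A^*|=(AA^* )^{1/2}$. The quadratic symmetric modulus of $A$ is $$|A|_{\mathrm{qsym}}:=\sqrt{\frac{|A|^2+|A^*|^2}{2}}\in\mathbb{M}_d^+.$$ For $A\in\mathbb{M}_d^+$, $\lambda_1^{\downarrow}(A)\ge\cdots\ge\lambda_d^{\downarrow}(A)$ are the eigenvalues of $A$ in nonincreasing order, with multiplicity, and by convention $\lambda_j^{\downarrow}(A):=0$ for $j>d$. *)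

(* Defs.v *)
From HB Require Import structures.
From mathcomp Require Import all_boot all_order all_algebra.
From mathcomp Require Import complex reals.

Set Implicit Arguments.
Unset Strict Implicit.
Unset Printing Implicit Defensive.
Import Order.TTheory GRing.Theory Num.Theory.
Local Open Scope ring_scope.
Local Open Scope sesquilinear_scope.

Definition psdmx (C : numClosedFieldType) (d : nat) (A : 'M[C]_d) : Prop :=
  A \is hermsymmx /\ forall u : 'rV[C]_d, 0 <= (u *m A *m u^t*) 0 0.

(* Functional calculus: A = U^* diag(x) U with U unitary is sent to
   U^* diag(sqrt x) U. Only meaningful for A positive semidefinite, where it is
   the unique positive semidefinite square root of A: see sqrtmx_psd, sqrtmxK
   and sqrtmx_uniq. *)
Definition sqrtmx (C : numClosedFieldType) (d : nat) (A : 'M[C]_d) : 'M[C]_d :=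
  (spectralmx A)^t* *m diag_mx (map_mx sqrtC (spectral_diag A)) *m spectralmx A.

Definition absmx (C : numClosedFieldType) (d : nat) (A : 'M[C]_d) : 'M[C]_d :=
  sqrtmx (A^t* *m A).

Definition qsymmx (C : numClosedFieldType) (d : nat) (A : 'M[C]_d) : 'M[C]_d :=
  sqrtmx (2^-1 *: (absmx A ^+ 2 + absmx (A^t*) ^+ 2)).

(* The roots of the characteristic polynomial, with multiplicity. *)
Definition eigenvalues (C : numClosedFieldType) (d : nat) (A : 'M[C]_d) : seq C :=
  sval (closed_field_poly_normal (char_poly A)).

(* Numbered from 1 (index 0 is a junk value) and 0 beyond d. Taking real parts
   loses nothing when A is Hermitian, see char_poly_eigdec. *)
Definition eigdec (R : realType) (d : nat) (A : 'M[R[i]]_d) (j : nat) : R :=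
  (sort >=%O [seq complex.Re z | z <- eigenvalues A])`_j.-1.

Section SquareRoot.
Variables (C : numClosedFieldType) (d : nat).
Implicit Types A B : 'M[C]_d.

Lemma psdmx_adj_mul A : psdmx (A^t* *m A).
Proof.
split.
  by apply/is_hermitianmxP; rewrite expr0 scale1r trmx_mul map_mxM trmxCK.
move=> u; rewrite mulmxA -mulmxA.
have -> : A *m u^t* = (u *m A^t*)^t* by rewrite trmx_mul map_mxM trmxCK.
by rewrite -dotmxE dnorm_ge0.
Qed.

Lemma psdmxD A B : psdmx A -> psdmx B -> psdmx (A + B).
Proof.
move=> [/is_hermitianmxP hA pA] [/is_hermitianmxP hB pB]; split.
  apply/is_hermitianmxP; move: hA hB; rewrite !expr0 !scale1r => hA hB.
  by rewrite linearD /= map_mxD -hA -hB.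
by move=> u; rewrite mulmxDr mulmxDl mxE addr_ge0.
Qed.

Lemma psdmxZ (a : C) A : 0 <= a -> psdmx A -> psdmx (a *: A).
Proof.
move=> a0 [/is_hermitianmxP hA pA]; split.
  apply/is_hermitianmxP; move: hA; rewrite !expr0 !scale1r => hA.
  by rewrite linearZ /= map_mxZ -hA /= (CrealP (ger0_real a0)).
by move=> u; rewrite -scalemxAr -scalemxAl mxE mulr_ge0.
Qed.

Lemma psdmx_spectral A : psdmx A ->
  A = (spectralmx A)^t* *m diag_mx (spectral_diag A) *m spectralmx A /\
  forall i, 0 <= spectral_diag A 0 i.
Proof.
move=> [hA pA]; have UU := spectral_unitarymx A.
have := @orthomx_spectralP _ _ A (hermitian_normalmx hA).
rewrite invmx_unitary // => eA; split=> // i.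
set U := spectralmx A in UU eA *; set D := diag_mx _ in eA.
pose e : 'rV[C]_d := delta_mx 0 i.
have -> : spectral_diag A 0 i = (e *m D *m e^t*) 0 0.
  by rewrite -rowE trmx_delta map_delta_mx -colE !mxE eqxx.
suff -> : e *m D *m e^t* = e *m U *m A *m (e *m U)^t* by exact: pA.
rewrite trmx_mul map_mxM eA !mulmxA (mulmxtVK _ UU).
by rewrite (mulmxtVK _ UU).
Qed.

Lemma sqrtmx_psd A : psdmx A -> psdmx (sqrtmx A).
Proof.
move=> /psdmx_spectral[_ ge0].
set D := map_mx sqrtC (map_mx sqrtC (spectral_diag A)).
suff -> : sqrtmx A = (diag_mx D *m spectralmx A)^t* *m (diag_mx D *m spectralmx A).
  exact: psdmx_adj_mul.
rewrite trmx_mul map_mxM tr_diag_mx map_diag_mx /= !mulmxA; congr (_ *m _).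
rewrite -!mulmxA mulmx_diag; congr (_ *m diag_mx _).
apply/rowP => i; rewrite !mxE.
have s0 : 0 <= sqrtC (spectral_diag A 0 i) by rewrite sqrtC_ge0.
have ss0 : 0 <= sqrtC (sqrtC (spectral_diag A 0 i)) by rewrite sqrtC_ge0.
by rewrite (CrealP (ger0_real ss0)) -expr2 sqrtCK.
Qed.

Lemma sqrtmxK A : psdmx A -> sqrtmx A ^+ 2 = A.
Proof.
move=> /psdmx_spectral[eA _]; have UU := spectral_unitarymx A.
rewrite [RHS]eA expr2 /sqrtmx -mulmxE !mulmxA (mulmxtVK _ UU).
rewrite -(mulmxA _ (diag_mx _) (diag_mx _)) mulmx_diag.
congr (_ *m diag_mx _ *m _); apply/rowP => i.
by rewrite !mxE -expr2 sqrtCK.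
Qed.

Lemma sqrtmx_uniq A B : psdmx A -> psdmx B -> B ^+ 2 = A -> B = sqrtmx A.
Proof.
move=> pA; move: (sqrtmx_psd pA) (sqrtmxK pA); move: (sqrtmx A) => B' pB' <- pB.
have [eB' D0] := psdmx_spectral pB'; have [eB E0] := psdmx_spectral pB.
have VV := spectral_unitarymx B'; have WW := spectral_unitarymx B.
move: (spectralmx B') (spectral_diag B') VV eB' D0 => V D VV eB' D0.
move: (spectralmx B) (spectral_diag B) WW eB E0 => W E WW eB E0 eq2.
have VV' : V^t* *m V = 1%:M by apply: mulmx1C; exact/unitarymxP.
have WW' : W^t* *m W = 1%:M by apply: mulmx1C; exact/unitarymxP.
pose M := W *m V^t*.
have EM2 : diag_mx E *m (diag_mx E *m M) = M *m diag_mx D *m diag_mx D.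
  have := congr1 (fun X => W *m X *m V^t*) eq2.
  rewrite !expr2 -!mulmxE {1 2}eB {1 2}eB' /M !mulmxA (unitarymxP WW) mul1mx.
  by rewrite (mulmxtVK _ WW) => ->; rewrite !(mulmxtVK _ VV).
have EM : diag_mx E *m M = M *m diag_mx D.
  move: M EM2 => M EM2; apply/matrixP => i k; move/matrixP/(_ i k): EM2.
  rewrite !mul_diag_mx !mul_mx_diag !mxE; move: (M i k) => x eq_x.
  have [->|x0] := eqVneq x 0; first by rewrite mulr0 mul0r.
  have /eqP : E 0 i ^+ 2 = D 0 k ^+ 2.
    by apply: (mulIf x0); rewrite !expr2 -mulrA eq_x -mulrA mulrC.
  by rewrite eqrXn2 // mulrC => /eqP ->.
have := congr1 (fun X => W^t* *m X *m V) EM.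
rewrite /M !mulmxA WW' mul1mx -eB' => <-.
by rewrite -[in RHS]mulmxA VV' mulmx1 -eB.
Qed.

Lemma absmx_psd A : psdmx (absmx A).
Proof. exact/sqrtmx_psd/psdmx_adj_mul. Qed.

Lemma absmx_sqr A : absmx A ^+ 2 = A^t* *m A.
Proof. exact/sqrtmxK/psdmx_adj_mul. Qed.

Lemma qsymmx_arg_psd A : psdmx (2^-1 *: (absmx A ^+ 2 + absmx (A^t*) ^+ 2)).
Proof.
apply: psdmxZ; first by rewrite invr_ge0 ler0n.
by apply: psdmxD; rewrite absmx_sqr; exact: psdmx_adj_mul.
Qed.

Lemma qsymmx_psd A : psdmx (qsymmx A).
Proof. exact/sqrtmx_psd/qsymmx_arg_psd. Qed.

End SquareRoot.

Lemma char_poly_eigenvalues (C : numClosedFieldType) (d : nat) (A : 'M[C]_d) :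
  char_poly A = \prod_(z <- eigenvalues A) ('X - z%:P).
Proof.
rewrite /eigenvalues; case: closed_field_poly_normal => s /= {1}->.
by rewrite (monicP (char_poly_monic A)) scale1r.
Qed.

Lemma size_eigenvalues (C : numClosedFieldType) (d : nat) (A : 'M[C]_d) :
  size (eigenvalues A) = d.
Proof.
have := size_char_poly A; rewrite char_poly_eigenvalues size_prod_XsubC.
by case.
Qed.

Lemma char_poly_eigdec (R : realType) (d : nat) (A : 'M[R[i]]_d) :
  A \is hermsymmx ->
  char_poly A = \prod_(1 <= j < d.+1) ('X - ((eigdec A j)%:C)%C%:P).
Proof.
move=> /is_hermitianmxP; rewrite expr0 scale1r => hA.
rewrite char_poly_eigenvalues.
rewrite big_add1 /= /eigdec /=.
set s := map _ _; set L := sort _ s.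
have perm_L : perm_eq L s by rewrite /L perm_sort.
rewrite -[X in index_iota _ X](_ : size L = d); last first.
  by rewrite (perm_size perm_L) size_map size_eigenvalues.
rewrite -(big_nth 0 predT (fun x => 'X - (x%:C)%C%:P)) (perm_big _ perm_L) big_map /=.
apply: eq_big_seq => z zA; congr ('X - _%:P).
apply/esym/RRe_real.
have : root (char_poly A) z by rewrite char_poly_eigenvalues root_prod_XsubC.
rewrite -eigenvalue_root_char => /eigenvalueP[v vA v0].
have vv : 0 < dotmx v v by rewrite dnorm_gt0.
have -> : z = (v *m A *m v^t*) 0 0 / dotmx v v.
  by rewrite vA -scalemxAl mxE -dotmxE mulfK // gt_eqF.
rewrite rpred_div ?(gtr0_real vv) //.
apply/CrealP.
transitivity ((v *m A *m v^t*)^t* 0 0); first by rewrite !mxE.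
by rewrite !(trmx_mul, map_mxM) trmxCK -hA mulmxA.
Qed.

(* Main.v *)
(** For [Q = |A|_qsym] the Hermitian matrices [H = [0, A; A^*, 0]] and
    [K = sqrt 2 diag(Q, Q)] satisfy [K^2 - H^2 = diag(A^* A, A A^* ) >= 0], hence
    [H <= K]; evaluated at a pair of vectors and summed over the [A_k], this
    gives [2 Re <u S, v> <= sqrt 2 (<u T, u> + <v T, v>)] with [S] the sum of
    the [A_k] and [T] the sum of the [|A_k|_qsym].  Let [E] be the subspace of
    codimension at most [j] spanned by the eigenvectors of [T] for eigenvalues
    at most [c = lambda_(1+j)(T)].  The vectors [x] such that both [x] and
    [x S^*] lie in [E] form a subspace of codimension at most [2j], on which
    choosing [v = x] and [u] a multiple of [x S^*] yields
    [|x S^*| <= sqrt 2 c |x|]. The min-max principle concludes. *)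
Require Import Defs.
From mathcomp Require Import all_boot all_order all_algebra.
From mathcomp Require Import complex reals ring.
Import Order.TTheory GRing.Theory Num.Theory.
Local Open Scope ring_scope.
Local Open Scope sesquilinear_scope.

(** * Similarity invariance of the characteristic polynomial, and order statistics *)

Lemma char_poly_conj (F : comUnitRingType) (n : nat) (P A : 'M[F]_n) :
  P \in unitmx -> char_poly (invmx P *m A *m P) = char_poly A.
Proof.
move=> uP; rewrite /char_poly.
have -> : char_poly_mx (invmx P *m A *m P) =
    map_mx polyC (invmx P) *m char_poly_mx A *m map_mx polyC P.
  rewrite /char_poly_mx mulmxBr mulmxBl !map_mxM scalar_mxC.
  by rewrite -(mulmxA 'X%:M) -(map_mxM _ (invmx P) P) mulVmx // map_mx1 mulmx1.
rewrite !det_mulmx mulrC mulrA -det_mulmx -map_mxM mulmxV // map_mx1 det1.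
by rewrite mul1r.
Qed.

Lemma nth_sort_ge_gtE (disp : Order.disp_t) (T : orderType disp) (x0 c : T)
    (s : seq T) (k : nat) : (k < size s)%N ->
  (c < nth x0 (sort >=%O s) k)%O = (k < count (> c)%O s)%N.
Proof.
move=> ks; have sS : sorted (>=%O : rel T) (sort >=%O s) by exact/sort_sorted/ge_total.
have <- : count (> c)%O (sort >=%O s) = count (> c)%O s.
  by apply/permP; rewrite perm_sort.
rewrite -(size_sort >=%O) in ks.
(* The sequence is nonincreasing, so the counting lemmas for sorted sequences are applied in the
   dual order [T^d]. *)
have [lt_k|le_k] := ltnP.
  exact: (@nth_count_lt _ T^d c x0 (sort >=%O s) k sS).
apply/negbTE; rewrite -leNgt.
by apply: (@nth_count_ge _ T^d c x0 (sort >=%O s) k sS); rewrite ks andbT.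
Qed.

(** * Quadratic forms of Hermitian matrices and kernels as subspaces *)

Section QuadraticForms.
Variable C : numClosedFieldType.
Local Notation "''[' u ]_ M" := ((u *m M *m u^t*) 0 0).

Lemma adjmxM m n p (A : 'M[C]_(m, n)) (B : 'M[C]_(n, p)) :
  (A *m B)^t* = B^t* *m A^t*.
Proof. by rewrite trmx_mul map_mxM. Qed.

Lemma adjmxZ m n (a : C) (A : 'M[C]_(m, n)) : (a *: A)^t* = a^* *: A^t*.
Proof. by rewrite linearZ /= map_mxZ. Qed.

Lemma hermsymmx_adj {n} {A : 'M[C]_n} : A \is hermsymmx -> A^t* = A.
Proof. by move=> /is_hermitianmxP; rewrite expr0 scale1r => <-. Qed.

Lemma adj_hermsymmx {n} (A : 'M[C]_n) : A^t* = A -> A \is hermsymmx.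
Proof. by move=> hA; apply/is_hermitianmxP; rewrite expr0 scale1r hA. Qed.

Lemma qform_diag n (U : 'M[C]_n) (D x : 'rV[C]_n) :
  '[x]_(U^t* *m diag_mx D *m U) = \sum_i D 0 i * `|(x *m U^t*) 0 i| ^+ 2.
Proof.
have -> : x *m (U^t* *m diag_mx D *m U) *m x^t* =
    (x *m U^t*) *m diag_mx D *m (x *m U^t*)^t*.
  by rewrite adjmxM trmxCK !mulmxA.
rewrite mul_mx_diag mxE; apply: eq_bigr => i _.
by rewrite !mxE mulrAC -normCK mulrC.
Qed.

Lemma dnorm_unitary n (U : 'M[C]_n) (x : 'rV[C]_n) : U \is unitarymx ->
  (x *m x^t*) 0 0 = \sum_i `|(x *m U^t*) 0 i| ^+ 2.
Proof.
move=> UU; have UU' : U^t* *m U = 1%:M by apply: mulmx1C; exact/unitarymxP.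
have -> : x *m x^t* = x *m (U^t* *m diag_mx (const_mx 1) *m U) *m x^t*.
  by rewrite diag_const_mx mulmx1 UU' mulmx1.
by rewrite qform_diag; apply: eq_bigr => i _; rewrite mxE mul1r.
Qed.

(** Operator monotonicity of the square root, by contradiction: the form of [K^2 - H^2] would be
    negative at an eigenvector of [K - H] for a negative eigenvalue. Only [K] is taken positive,
    since the block matrix to which this is applied as [H] is indefinite in general. *)
Lemma hermitian_sqr_le n (H K : 'M[C]_n) :
  H \is hermsymmx -> psdmx K -> (forall u : 'rV_n, 0 <= '[u]_(K *m K - H *m H)) ->
  forall u : 'rV_n, '[u]_H <= '[u]_K.
Proof.
move=> hH [hK pK] sqr_le.
have aH := hermsymmx_adj hH; have aK := hermsymmx_adj hK.
pose M := K - H.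
have hM : M \is hermsymmx by apply: adj_hermsymmx; rewrite linearB map_mxB aH aK.
have UU := spectral_unitarymx M.
have := @orthomx_spectralP _ _ M (hermitian_normalmx hM).
rewrite invmx_unitary //.
have /mxOverP realD := hermitian_spectral_diag_real hM.
move: (spectralmx M) (spectral_diag M) UU realD => U D UU realD eM.
suff D0 i : 0 <= D 0 i.
  move=> u; rewrite -subr_ge0.
  have -> : '[u]_K - '[u]_H = '[u]_M by rewrite /M mulmxBr mulmxBl !mxE.
  by rewrite eM qform_diag sumr_ge0 // => i _; rewrite mulr_ge0 ?exprn_ge0.
rewrite real_leNgt ?real0 ?realD //; apply/negP => D_lt0.
pose v := row i U.
have vM : v *m M = D 0 i *: v.
  rewrite /v [in LHS]eM !mulmxA -row_mul (unitarymxP UU) row1.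
  by rewrite -rowE row_diag_mx -scalemxAl -rowE.
have vv : v *m v^t* = 1%:M.
  rewrite [LHS]mx11_scalar -dotmxE.
  by have /row_unitarymxP -> := UU; rewrite eqxx.
(* With [t := - D 0 i > 0], [v H = v K + t v] and so
   [|v H|^2 = |v K|^2 + 2 t <v K, v> + t^2 > |v K|^2]. *)
have vH : v *m H = v *m K - D 0 i *: v.
  by rewrite -vM /M mulmxBr opprB addrCA subrr addr0.
apply/negP: (sqr_le v); rewrite lt_geF //.
have Dc : (D 0 i)^* = D 0 i by exact/CrealP/realD.
have -> : v *m (K *m K - H *m H) *m v^t* =
    (v *m K) *m (v *m K)^t* - (v *m H) *m (v *m H)^t*.
  by rewrite !adjmxM aH aK !mulmxA mulmxBr mulmxBl !mulmxA.
have Kv : v *m (v *m K)^t* = v *m K *m v^t* by rewrite adjmxM aK mulmxA.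
rewrite vH linearB map_mxB /= -/((D 0 i *: v)^t*) adjmxZ Dc.
rewrite mulmxBl !mulmxBr -!scalemxAl -!scalemxAr Kv vv.
move: (v *m K *m _^t*) (v *m K *m v^t*) (pK v) => a q.
rewrite !mxE mulr1; move: (a 0 0) (q 0 0) (D 0 i) D_lt0 => {}a {}q t t_lt0 q0.
have -> : a - (a - t * q - (t * q - t * t)) = 2 * (t * q) - t * t.
  by ring.
rewrite subr_lt0; apply: (@le_lt_trans _ _ 0).
  by rewrite pmulr_rle0 // nmulr_rle0.
by rewrite nmulr_rgt0.
Qed.

Lemma qsymmx_bound n (A : 'M[C]_n) (r : C) (u v : 'rV[C]_n) :
  0 <= r -> r ^+ 2 = 2 ->
  (u *m A *m v^t* + v *m A^t* *m u^t*) 0 0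
    <= r * ('[u]_(qsymmx A) + '[v]_(qsymmx A)).
Proof.
move=> r0 r2.
have [hQ pQ] := qsymmx_psd A.
have aQ := hermsymmx_adj hQ.
have := sqrtmxK (qsymmx_arg_psd A); rewrite -/(qsymmx A) !absmx_sqr trmxCK.
set Q := qsymmx A in hQ pQ aQ *; rewrite expr2 -mulmxE => QQ.
pose H : 'M[C]_(n + n) := block_mx 0 A (A^t*) 0.
pose K : 'M[C]_(n + n) := r *: block_mx Q 0 0 Q.
have qK x y : '[row_mx x y]_K = r * ('[x]_Q + '[y]_Q).
  rewrite /K -scalemxAr -scalemxAl mxE mul_row_block tr_row_mx map_col_mx.
  by rewrite !mulmx0 addr0 add0r mul_row_col mxE.
have qH x y : '[row_mx x y]_H = (x *m A *m y^t* + y *m A^t* *m x^t*) 0 0.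
  rewrite /H mul_row_block tr_row_mx map_col_mx.
  by rewrite !mulmx0 addr0 add0r mul_row_col addrC.
have hH : H \is hermsymmx.
  apply: adj_hermsymmx.
  by rewrite /H tr_block_mx map_block_mx !trmx0 !map_mx0 trmxCK.
have pK : psdmx K.
  split.
    apply: adj_hermsymmx; rewrite /K adjmxZ (CrealP (ger0_real r0)).
    by rewrite tr_block_mx map_block_mx !trmx0 !map_mx0 aQ.
  by move=> w; rewrite -(hsubmxK w) qK mulr_ge0 ?addr_ge0.
rewrite -qH -qK; apply: hermitian_sqr_le => // w.
(* Here [K^2] has diagonal blocks [2 Q^2 = A^* A + A A^*], and [H^2] has diagonal blocks [A A^*] and
   [A^* A]. *)
have -> : K *m K - H *m H = block_mx (A^t* *m A) 0 0 (A *m A^t*).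
  rewrite /K /H -scalemxAl -scalemxAr scalerA -expr2 r2.
  rewrite !mulmx_block !mulmx0 !mul0mx !addr0 !add0r QQ.
  rewrite scale_block_mx scaler0 scalerA divff ?pnatr_eq0 // scale1r.
  rewrite opp_block_mx add_block_mx oppr0 !addr0.
  by rewrite addrK addrAC subrr add0r.
rewrite -(hsubmxK w) mul_row_block tr_row_mx map_col_mx.
rewrite !mulmx0 addr0 add0r mul_row_col mxE addr_ge0 //.
  by have [_] := psdmx_adj_mul A; exact.
have [_] := psdmx_adj_mul (A^t*); rewrite trmxCK; exact.
Qed.

(** The columns of [N] are the eigenvectors for eigenvalues above [c], so [x *m N = 0] kills exactly
    those coordinates. Writing the subspace as a kernel turns intersections into concatenations of
    columns, and the number of columns bounds the codimension. *)
Lemma psdmx_ker_le n (M : 'M[C]_n) (c : C) : psdmx M -> 0 <= c ->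
  exists N : 'M[C]_(n, #|[set i | (c < spectral_diag M 0 i)%R]|),
    forall x : 'rV_n, x *m N = 0 -> '[x]_M <= c * (x *m x^t*) 0 0.
Proof.
move=> pM c0; set P := [set i | _]. have UU := spectral_unitarymx M.
have [eM D0] := psdmx_spectral pM.
pose N := colsub (@enum_val _ (mem P)) ((spectralmx M)^t*).
exists N => x xN0.
rewrite {1}eM qform_diag (dnorm_unitary _ _ _ UU) mulr_sumr; apply: ler_sum => i _.
have [iP|iP] := boolP (i \in P).
  have /rowP/(_ (enum_rank_in iP i)) := xN0.
  have -> : x *m N = colsub (@enum_val _ (mem P)) (x *m (spectralmx M)^t*).
    by rewrite /N mulmx_colsub.
  by rewrite !mxE enum_rankK_in // => ->; rewrite normr0 expr0n /= !mulr0.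
apply: ler_wpM2r; first by rewrite exprn_ge0.
move: iP; rewrite inE real_ltNge ?ger0_real //.
by rewrite negbK.
Qed.

(** Dimension count behind min-max: the eigenvectors for eigenvalues above [c] span a space of
    dimension greater than [p], which meets the kernel of [N] nontrivially. The form of [M^2] is
    used because for [M = |S|] it is [|x S^*|^2]. *)
Lemma psdmx_ker_gt n p (M : 'M[C]_n) (c : C) (N : 'M[C]_(n, p)) :
  psdmx M -> 0 <= c -> (p < #|[set i | (c < spectral_diag M 0 i)%R]|)%N ->
  exists2 x : 'rV_n, x *m N = 0 & c ^+ 2 * (x *m x^t*) 0 0 < '[x]_(M *m M).
Proof.
move=> pM c0; set P := [set i | _] => lt_p.
have UU := spectral_unitarymx M; have [eM D0] := psdmx_spectral pM.
pose W := rowsub (@enum_val _ (mem P)) (spectralmx M).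
have /rowV0Pn[y] : kermx (W *m N) != 0.
  rewrite -mxrank_eq0 mxrank_ker -lt0n subn_gt0.
  exact: leq_ltn_trans (rank_leq_col _) lt_p.
rewrite sub_kermx => /eqP yWN y0.
exists (y *m W); first by rewrite -mulmxA.
set x := y *m W.
(* By orthonormality, the coordinates of [x] in the eigenbasis are those of [y] on [P] and zero
   elsewhere. *)
have xU : x *m (spectralmx M)^t* = y *m rowsub (@enum_val _ (mem P)) 1%:M.
  by rewrite /x /W rowsubE mulmxA mulmxtVK.
have xin k : (x *m (spectralmx M)^t*) 0 (enum_val k) = y 0 k.
  rewrite xU mxE (bigD1 k) //= !mxE eqxx mulr1 big1 ?addr0 // => l lk.
  by rewrite !mxE (inj_eq enum_val_inj) (negbTE lk) mulr0.
have xout i : i \notin P -> (x *m (spectralmx M)^t*) 0 i = 0.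
  move=> iP; rewrite xU mxE big1 // => l _; rewrite !mxE.
  case: eqP => [li|]; last by rewrite mulr0.
  by move: (enum_valP l); rewrite li (negbTE iP).
have -> : M *m M = (spectralmx M)^t* *m
    diag_mx (\row_i (spectral_diag M 0 i * spectral_diag M 0 i)) *m spectralmx M.
  by rewrite -mulmx_diag {1 2}eM !mulmxA mulmxtVK.
rewrite qform_diag (dnorm_unitary _ _ _ UU) mulr_sumr.
have /rV0Pn[k yk] := y0.
have gt_c i : i \in P -> c ^+ 2 < spectral_diag M 0 i * spectral_diag M 0 i.
  by rewrite inE -expr2 => lt_c; rewrite ltrXn2r // qualifE.
(* A nonzero coordinate of [y] is split off: it makes the inequality strict. *)
rewrite (bigD1 (enum_val k)) //= [ltRHS](bigD1 (enum_val k)) //=.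
apply: ltr_leD.
  rewrite mxE ltr_pM2r ?gt_c ?enum_valP //.
  by rewrite xin exprn_gt0 // normr_gt0.
apply: ler_sum => i _; have [iP|iP] := boolP (i \in P).
  by rewrite mxE ler_wpM2r ?exprn_ge0 // ltW // gt_c.
by rewrite xout // normr0 expr0n /= !mulr0.
Qed.
End QuadraticForms.

(** * Ordered eigenvalues of positive semidefinite matrices *)

Section Eigdec.
Variables (R : realType) (d : nat).
Implicit Types M : 'M[R[i]]_d.

Lemma eigenvalues_spectral M : psdmx M ->
  perm_eq (eigenvalues M) [seq spectral_diag M 0 i | i : 'I_d].
Proof.
move=> /psdmx_spectral[eM _].
apply: prod_XsubC_eq; rewrite -char_poly_eigenvalues big_image /=.
have UU := spectral_unitarymx M.
rewrite [in LHS]eM -invmx_unitary // char_poly_conj ?unitarymx_unit //.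
rewrite char_poly_trig ?diag_mx_is_trig //.
by apply: eq_bigr => i _; rewrite mxE eqxx.
Qed.

Lemma eigdec_ge0 M j : psdmx M -> 0 <= eigdec M j.
Proof.
move=> pM; have [_ D0] := psdmx_spectral pM; rewrite /eigdec.
set s := sort _ _.
have [s_le|s_gt] := leqP (size s) j.-1; first by rewrite nth_default.
have : s`_j.-1 \in s by exact: mem_nth.
rewrite mem_sort => /mapP[z].
rewrite (perm_mem (eigenvalues_spectral _ pM)) => /imageP[i _ ->] ->.
by rewrite -lecR RRe_real // ger0_real.
Qed.

Lemma eigdec_gtE M (c : R) k : psdmx M -> 0 <= c ->
  (c < eigdec M k.+1) = (k < #|[set i | (c%:C%C < spectral_diag M 0 i)%R]|)%N.
Proof.
move=> pM c0; have [_ D0] := psdmx_spectral pM.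
have DE i : (complex.Re (spectral_diag M 0 i))%:C%C = spectral_diag M 0 i.
  by rewrite RRe_real // ger0_real.
(* Beyond [d] the eigenvalue is 0 by default, and both sides are false because [0 <= c] and at most
   [d] indices exist. *)
have [k_ge|k_lt] := leqP d k.
  rewrite /eigdec nth_default ?size_sort ?size_map ?size_eigenvalues //.
  rewrite ltNge c0; apply/esym/negbTE; rewrite -leqNgt (leq_trans _ k_ge) //.
  by rewrite (leq_trans (max_card _)) ?card_ord.
rewrite nth_sort_ge_gtE ?size_map ?size_eigenvalues // count_map.
have /permP -> := eigenvalues_spectral _ pM.
rewrite count_map cardE size_filter -enumT; congr (_ < _)%N.
apply: eq_count => i /=.
by rewrite inE -ltcR DE.
Qed.
End Eigdec.

(** * The eigenvalue inequality, by min-max *)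

Theorem corollary2p7 (R : realType) (d m : nat) (hd : (1 <= d)%N) (hm : (1 <= m)%N)
    (A : 'I_m -> 'M[R[i]]_d) (j : nat) :
  eigdec (absmx (\sum_(k < m) A k)) (1 + 2 * j)%N
    <= Num.sqrt 2 * eigdec (\sum_(k < m) qsymmx (A k)) (1 + j)%N.
Proof.
set S := \sum_(k < m) A k; set T := \sum_(k < m) qsymmx (A k).
have pT : psdmx T.
  apply: (big_ind (@psdmx _ d)) => [||k _]; last exact: qsymmx_psd.
    split; first by apply: adj_hermsymmx; rewrite trmx0 map_mx0.
    by move=> u; rewrite mulmx0 mul0mx mxE.
  exact: psdmxD.
rewrite !add1n; set c := eigdec T j.+1.
have c0 : 0 <= c by exact: eigdec_ge0.
have b0 : 0 <= Num.sqrt 2 * c by rewrite mulr_ge0 ?sqrtr_ge0.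
rewrite leNgt eigdec_gtE //; last exact: absmx_psd.
apply/negP => lt_j.
pose r : R[i] := (Num.sqrt 2)%:C%C.
have r0 : 0 <= r by rewrite lecR sqrtr_ge0.
have r2 : r ^+ 2 = 2.
  by rewrite -rmorphXn /= sqr_sqrtr ?ler0n // rmorph_nat.
have cC0 : 0 <= c%:C%C by rewrite lecR.
have [N Nle] := psdmx_ker_le _ _ _ _ pT cC0.
have le_j : (#|[set i | (c%:C%C < spectral_diag T 0 i)%R]| <= j)%N.
  by rewrite leqNgt -eigdec_gtE // ltxx.
have bC0 : 0 <= (Num.sqrt 2 * c)%:C%C by rewrite lecR.
have lt_N : (#|[set i | (c%:C%C < spectral_diag T 0 i)%R]| +
    #|[set i | (c%:C%C < spectral_diag T 0 i)%R]| <
    #|[set i | ((Num.sqrt 2 * c)%:C%C < spectral_diag (absmx S) 0 i)%R]|)%N.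
  by apply: leq_ltn_trans lt_j; rewrite mul2n -addnn leq_add.
(* The two blocks of columns impose [x N = 0] and [x S^* N = 0]: at most [2j] conditions, against
   more than [2j] eigenvalues of [|S|] above [sqrt 2 c]. *)
have [x] := psdmx_ker_gt _ _ _ _ _ (row_mx N (S^t* *m N)) (absmx_psd S) bC0 lt_N.
rewrite mul_mx_row -row_mx0 => /eq_row_mx[xN]; rewrite mulmxA => ySN.
rewrite mulmxE -expr2 absmx_sqr mulmxA.
have S_bound (u v : 'rV_d) : (u *m S *m v^t* + v *m S^t* *m u^t*) 0 0
    <= r * ((u *m T *m u^t*) 0 0 + (v *m T *m v^t*) 0 0).
  have -> : r * ((u *m T *m u^t*) 0 0 + (v *m T *m v^t*) 0 0) =
      \sum_(k < m) r * ((u *m qsymmx (A k) *m u^t*) 0 0 +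
                        (v *m qsymmx (A k) *m v^t*) 0 0).
    by rewrite -mulr_sumr big_split /= /T !mulmx_sumr !mulmx_suml !summxE.
  have -> : (u *m S *m v^t* + v *m S^t* *m u^t*) 0 0 =
      \sum_(k < m) (u *m A k *m v^t* + v *m (A k)^t* *m u^t*) 0 0.
    have -> : S^t* = \sum_(k < m) (A k)^t* by rewrite /S !raddf_sum.
    by rewrite -summxE big_split /= /S !mulmx_sumr !mulmx_suml.
  by apply: ler_sum => k _; exact: qsymmx_bound.
set y := x *m S^t* in ySN *.
have yy : y *m S *m x^t* = y *m y^t* by rewrite /y adjmxM trmxCK !mulmxA.
rewrite yy.
set p := (x *m x^t*) 0 0; set q := (y *m y^t*) 0 0.
have Tx : (x *m T *m x^t*) 0 0 <= c%:C%C * p by exact: Nle.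
have Ty : (y *m T *m y^t*) 0 0 <= c%:C%C * q by exact: Nle.
have p0 : 0 <= p by rewrite /p -dotmxE dnorm_ge0.
have q0 : 0 <= q by rewrite /q -dotmxE dnorm_ge0.
have bE : (Num.sqrt 2 * c)%:C%C = r * c%:C%C by rewrite rmorphM.
rewrite bE in bC0 *; set b := r * _ in bC0 *.
(* This is [S_bound] at [u = s y] and [v = x], where [p = |x|^2] and [q = |x S^*|^2]; it remains to
   choose [s] so as to get [q <= b^2 p]. *)
have main (s : R[i]) : 0 <= s -> 2 * s * q <= b * (s ^+ 2 * q + p).
  move=> s0; have sc := CrealP (ger0_real s0).
  have := S_bound (s *: y) x; rewrite adjmxZ sc.
  rewrite -!scalemxAl -!scalemxAr -/y yy.
  have zE (a : R[i]) (M : 'M_1) : (a *: M) 0 0 = a * M 0 0 by rewrite mxE.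
  rewrite mxE !zE -/q.
  have -> : 2 * s * q = s * q + s * q by ring.
  move=> h; apply: (le_trans h).
  rewrite /b -mulrA; apply: ler_wpM2l => //; rewrite mulrDr lerD //.
  by rewrite mulrA -expr2 mulrCA; apply: ler_wpM2l; rewrite ?exprn_ge0.
apply/negP; rewrite -real_leNgt ?ger0_real ?mulr_ge0 ?exprn_ge0 //.
(* The optimal choice is [s = 1 / b]; for [b = 0], [s = 1] already forces [q <= 0]. *)
have [b_eq0|b_neq0] := eqVneq b 0.
  have := main 1 ler01; rewrite b_eq0 !mul0r expr0n /= mul0r mulr1.
  by rewrite pmulr_rle0.
have b_gt0 : 0 < b by rewrite lt_def b_neq0.
have := main b^-1; rewrite invr_ge0 => /(_ bC0).
rewrite -(ler_pM2l b_gt0).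
have -> : b * (2 * b^-1 * q) = q + q by field.
have -> : b * (b * (b^-1 ^+ 2 * q + p)) = q + b ^+ 2 * p by field.
by rewrite lerD2l.
Qed.
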